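(* Let $d\ge 4$ be an even integer and suppose that $d=r+s$ for some integers $1\le s<r$. Suppose that $\alpha\neq\beta$ in $\mathbb{T}$ satisfy Condition (P) (with respect to $r,s$). Let $d_0=\frac{d-2}{2}$ and $V:=\alpha I_r\oplus\beta I_s\in\mathcal{U}(\mathbb{C}^d)$. The following statements are equivalent: (a) $V\in\mathrm{Sym}_3(\mathbb{C}^d)$. (b) $r=d_0+2$, $s=d_0$, $\alpha^r\beta^s=(-1)^{d_0+1}$, and $|1-\alpha^{2j+1}\beta^{2j-1}|<|\alpha-\beta|$ for all $1\le j\le d_0$.
   Context: $\mathbb{T}=\{z\in\mathbb{C}:|z|=1\}$; $\mathcal{U}(\mathbb{C}^d)$ is the group of unitary $d\times d$ matrices. A symmetry on $\mathbb{C}^d$ is an operator $J$ with $J=J^*=J^{-1}$. $\mathrm{Sym}_k(\mathbb{C}^d)$ is the set of all products $J_1J_2\cdots J_k$ of $k$ symmetries on $\mathbb{C}^d$. Condition (P): for $d=r+s$ with integers $1\le s\le r$, the numbers $\alpha\ne\beta\in\mathbb{T}$ satisfy Condition (P) if (i) $\alpha^r\beta^s\in\{-1,1\}$, and (ii) whenever $i,j\ge 0$ are integers, not both zero, with $\alpha^i\beta^j\in\{-1,1\}$, then $i+j\ge d$. (In particular $\alpha,\beta\notin\{-1,1\}$.) *)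

(* Defs.v *)
From HB Require Import structures.
From mathcomp Require Import all_boot all_order all_algebra.
From mathcomp Require Import reals complex.
Set Implicit Arguments.
Unset Strict Implicit.
Unset Printing Implicit Defensive.
Import Order.TTheory GRing.Theory Num.Theory.
Local Open Scope ring_scope.
Local Open Scope sesquilinear_scope.

(* [invmx J] is [J] itself when [J] is singular, hence the invertibility
   clause. *)
Definition is_symmetry (C : numClosedFieldType) (d : nat) (J : 'M[C]_d) : Prop :=
  [/\ J \in unitmx, J = J ^t* & J = invmx J].

(* The product is the ordered one, J 0 *m J 1 *m ... *m J (k - 1). *)
Definition in_Sym (C : numClosedFieldType) (k d : nat) (V : 'M[C]_d) : Prop :=
  exists J : 'I_k -> 'M[C]_d,
    (forall i, is_symmetry (J i)) /\ V = \prod_(i < k) J i.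

(* Clauses (i) and (ii) of Condition (P) for d = r + s; the ambient requirements
   1 <= s <= r, |a| = |b| = 1 and a <> b are not included. *)
Definition condP (C : numClosedFieldType) (r s : nat) (a b : C) : Prop :=
  (a ^+ r * b ^+ s = -1 \/ a ^+ r * b ^+ s = 1) /\
  (forall i j : nat, ~ (i = 0%N /\ j = 0%N) ->
     (a ^+ i * b ^+ j = -1 \/ a ^+ i * b ^+ j = 1) -> (r + s <= i + j)%N).

(* Main.v *)
(* Let V have eigenvalues alpha (r times) and beta (s times).  If V = J K L with
   J, K, L symmetries, then W := J V = K L is conjugate to its inverse by K, so
   E(l) and E(1/l) have the same dimension, E(l) denoting the eigenspaces of W.
   Since V is quadratic, W J W = (alpha + beta) W - alpha beta J; hence the span
   of an eigenvector x for l and of x J is stable under W, and E(l) and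
   E(- alpha beta / l) have the same dimension unless l is one of +-alpha,
   +-beta.  As r > s, J and V have a common eigenvector, so that e alpha is an
   eigenvalue of W for some sign e, and alternating the two symmetries of the
   spectrum yields the chain of eigenvalues e (- alpha beta)^k alpha.
   Condition (P) keeps the chain away from the exceptional values until it has
   filled the space, and counting dimensions forces r - s = 2.  The strict
   inequalities say that the compression of J to an eigenline of W lies in
   ]-1, 1[.  Conversely the chain is built explicitly: W is a diagonal matrix
   whose eigenvalues are paired by inversion, hence a product of two
   symmetries, and J pairs them, with a shift, by l -> - alpha beta / l. *)
Require Import Defs.
From mathcomp Require Import all_boot all_order all_fingroup all_algebra.
From mathcomp Require Import reals complex.
From mathcomp Require Import ring zify.
Import Order.TTheory GRing.Theory Num.Theory.
Local Open Scope ring_scope.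
Local Open Scope sesquilinear_scope.

(** * Symmetries and their triple products *)

Lemma is_symmetryP {C : numClosedFieldType} {d : nat} (J : 'M[C]_d) :
  is_symmetry J <-> J ^t* = J /\ J *m J = 1%:M.
Proof.
split=> [[uJ hJ eJ]|[hJ JJ]]; first by split; rewrite // {2}eJ mulmxV.
have [uJ _] := mulmx1_unit JJ; split=> //.
by rewrite -[LHS]mulmx1 -(mulmxV uJ) mulmxA JJ mul1mx.
Qed.

Lemma in_Sym3P {C : numClosedFieldType} {d : nat} (V : 'M[C]_d) :
  in_Sym 3 V <-> exists J1 J2 J3 : 'M[C]_d,
    [/\ is_symmetry J1, is_symmetry J2, is_symmetry J3 & V = J1 *m J2 *m J3].
Proof.
split=> [[J [symJ ->]]|[J1 [J2 [J3 [s1 s2 s3 ->]]]]].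
  exists (J 0), (J 1), (J (lift 0 (lift 0 0))); split=> //.
  rewrite !big_ord_recl big_ord0 mulr1 -mulmxE mulmxA.
  by congr (_ *m J _ *m J _); apply: val_inj.
exists (fun i => nth J3 [:: J1; J2; J3] i); split.
  by case=> [[|[|[|?]]] ?].
by rewrite !big_ord_recl big_ord0 mulr1 -mulmxE mulmxA.
Qed.

(** * Hermitian forms *)

Lemma trCmx_mul {C : numClosedFieldType} {m n p : nat}
    (A : 'M[C]_(m, n)) (B : 'M[C]_(n, p)) : (A *m B) ^t* = B ^t* *m A ^t*.
Proof. by rewrite trmx_mul map_mxM. Qed.

Lemma dotmx_ge0 {C : numClosedFieldType} {n : nat} (x : 'rV[C]_n) :
  0 <= (x *m x ^t*) 0 0.
Proof.
by rewrite mxE sumr_ge0 // => i _; rewrite !mxE mul_conjC_ge0.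
Qed.

Lemma dotmx_gt0 {C : numClosedFieldType} {n : nat} (x : 'rV[C]_n) :
  x != 0 -> 0 < (x *m x ^t*) 0 0.
Proof.
move=> x0; rewrite lt0r dotmx_ge0 andbT; apply: contra_neq x0 => /eqP.
rewrite mxE psumr_eq0 => [/allP x0|i _]; last by rewrite !mxE mul_conjC_ge0.
apply/rowP=> i; have := x0 i (mem_index_enum _).
by rewrite !mxE mul_conjC_eq0 => /eqP.
Qed.

(** For a sign [e], [1 + e J] is self-adjoint and its square is twice itself, so twice the form of
    [1 + e J] at [x] is the squared norm of [x (1 + e J)]. *)
Lemma sym_form_le {C : numClosedFieldType} {n : nat} (J : 'M[C]_n) (x : 'rV[C]_n) :
  J ^t* = J -> J *m J = 1%:M ->
  - (x *m x ^t*) 0 0 <= (x *m J *m x ^t*) 0 0 <= (x *m x ^t*) 0 0.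
Proof.
move=> hJ JJ; set q := (x *m J *m _) 0 0; set p := (x *m _) 0 0.
have H (e : C) : e \is Num.real -> e ^+ 2 = 1 -> 0 <= 2%:R * (p + e * q).
  move=> eR ee; have := dotmx_ge0 (x *m (1%:M + e *: J)).
  have -> : (x *m (1%:M + e *: J)) ^t* = (1%:M + e *: J) *m x ^t*.
    rewrite trCmx_mul linearD linearZ /= map_mxD map_mxZ hJ /= (CrealP eR).
    by rewrite tr_scalar_mx map_scalar_mx rmorph1.
  have M2 : (1%:M + e *: J) *m (1%:M + e *: J) = 2%:R *: (1%:M + e *: J).
    rewrite mulmxDl !mulmxDr !mul1mx mulmx1 -scalemxAl -scalemxAr JJ scalerA.
    by rewrite -expr2 ee scale1r [e *: J + _]addrC scaler_nat mulr2n.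
  rewrite mulmxA -(mulmxA x) M2 -scalemxAr -scalemxAl mulmxDr mulmx1 -scalemxAr.
  by rewrite mulmxDl -scalemxAl !mxE /p /q !mxE.
rewrite -[- p <= q]subr_ge0 -[q <= p]subr_ge0.
have := H 1 (real1 _) (expr1n _ _); have := H (-1) (rpredN1 _) (sqrr_sign _ 1).
rewrite !pmulr_rge0 ?ltr0n // mulN1r mul1r opprK [q + p]addrC.
by move=> -> ->.
Qed.

(** * Eigenspaces of [W = J V] *)

Lemma mul_conj_reflection {R : comPzRingType} {n : nat} (a b : R) (J V : 'M[R]_n) :
  J *m J = 1%:M -> V *m V = (a + b) *: V - (a * b)%:M ->
  J *m V *m J *m (J *m V) = (a + b) *: (J *m V) - (a * b) *: J.
Proof.
move=> JJ VV; rewrite mulmxA -(mulmxA (J *m V) J J) JJ mulmx1 -mulmxA VV.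
by rewrite mulmxBr -scalemxAr mul_mx_scalar.
Qed.

(* For x in the eigenspace of l, x (J - t) lies in that of - (a b) / l. *)
Lemma rank_eigenspace_refl {F : fieldType} {n : nat} (a b l : F) (J W : 'M[F]_n) :
  J *m J = 1%:M -> W *m J *m W = (a + b) *: W - (a * b) *: J ->
  l != 0 -> l ^+ 2 != a ^+ 2 -> l ^+ 2 != b ^+ 2 ->
  (\rank (eigenspace W l) <= \rank (eigenspace W (- (a * b) / l)))%N.
Proof.
move=> JJ WJW l0 la lb.
have [e|ne] := eqVneq (l ^+ 2 + a * b) 0.
  suff -> : - (a * b) / l = l by [].
  by rewrite -(addr0_eq e) opprK expr2 mulfK.
(* Since [x J W = (a + b) x - (a b / l) x J], the vector [x (J - t)] is an eigenvector for
   [- a b / l] exactly when [t (l + a b / l) = a + b]. *)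
pose t := (a + b) * l / (l ^+ 2 + a * b).
(* As [(J - t) (J + t) = 1 - t ^+ 2], this makes [J - t] invertible, so it preserves ranks. *)
have t1 : 1 - t ^+ 2 != 0.
  have -> : 1 - t ^+ 2 =
      (l ^+ 2 - a ^+ 2) * (l ^+ 2 - b ^+ 2) / (l ^+ 2 + a * b) ^+ 2.
    by rewrite /t; field.
  by rewrite mulf_neq0 ?invr_eq0 ?expf_neq0 // mulf_neq0 // subr_eq0.
have Ju : J - t%:M \in unitmx.
  have : (J - t%:M) *m ((1 - t ^+ 2)^-1 *: (J + t%:M)) = 1%:M.
    rewrite -scalemxAr mulmxDr !mulmxBl JJ mul_mx_scalar mul_scalar_mx.
    rewrite -scalar_mxM addrA subrK -raddfB scale_scalar_mx /= -expr2.
    by rewrite mulVf.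
  by case/mulmx1_unit.
set E := eigenspace W l.
rewrite -(mxrankMfree E (_ : row_free (J - t%:M))) ?row_free_unit //.
apply/mxrankS/eigenspaceP; have : E *m W = l *: E by apply/eigenspaceP.
move: E => E EW.
have EJW : E *m J *m W = (a + b) *: E - (a * b / l) *: (E *m J).
  apply: (scalerI l0).
  have -> : l *: (E *m J *m W) = E *m (W *m J *m W).
    by rewrite !mulmxA EW -!scalemxAl.
  rewrite WJW mulmxBr -!scalemxAr EW scalerBr !scalerA [l * (a + b)]mulrC.
  by rewrite [l * _]mulrC divfK.
rewrite mulmxBr mulmxBl EJW mul_mx_scalar -scalemxAl EW scalerBr !scalerA.
rewrite addrAC -scalerBl [RHS]addrC -!scaleNr; congr (_ *: _ + _ *: _).
  by rewrite /t; field; apply/andP.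
by rewrite mulNr.
Qed.

(** If [x W = l x], then [x K = x W K W = l x K W]: the invertible [K] carries the eigenspace of [l]
    into that of [l^-1]. *)
Lemma rank_eigenspace_inv {F : fieldType} {n : nat} (l : F) (K W : 'M[F]_n) :
  K *m K = 1%:M -> W *m K *m W = K -> l != 0 ->
  (\rank (eigenspace W l) <= \rank (eigenspace W l^-1))%N.
Proof.
move=> KK WKW l0; set E := eigenspace W l.
have [Ku _] := mulmx1_unit KK.
rewrite -(mxrankMfree E (_ : row_free K)) ?row_free_unit //.
apply/mxrankS/eigenspaceP; have : E *m W = l *: E by apply/eigenspaceP.
move: E => E EW.
apply: (scalerI l0); rewrite scalerA mulfV // scale1r.
by rewrite !scalemxAl -EW -!mulmxA [W *m _]mulmxA WKW.
Qed.

(** Apply rank-nullity on [A] to [J - 1] and to [J + 1]. Their product is zero, so their ranks add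
    up to at most [n]. *)
Lemma rank_cap_involution {F : fieldType} {n : nat} (A J : 'M[F]_n) :
  J *m J = 1%:M ->
  (2 * \rank A <= \rank (A :&: eigenspace J 1) + \rank (A :&: eigenspace J (-1)) + n)%N.
Proof.
move=> JJ.
have key (P Q : 'M[F]_n) : P *m Q = 0 ->
    (2 * \rank A <= \rank (A :&: kermx P) + \rank (A :&: kermx Q) + n)%N.
  move=> /mulmx0_rank_max PQ.
  have := mxrank_mul_ker A P; have := mxrank_mul_ker A Q.
  by have := mxrankM_maxr A P; have := mxrankM_maxr A Q; lia.
apply: key; rewrite raddfN /= opprK.
by rewrite mulmxDr !mulmxBl JJ !mul1mx mulmx1 addrA subrK subrr.
Qed.

Lemma sum_rank_eigenspace_le {F : fieldType} {n : nat} {I : finType}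
    (W : 'M[F]_n) (l : I -> F) :
  injective l -> (\sum_i \rank (eigenspace W (l i)) <= n)%N.
Proof.
move=> inj_l; have := mxdirect_sum_eigenspace W (P := xpredT) (a_ := l).
by move=> /(_ (in2W inj_l)) /mxdirectP /= <-; apply: rank_leq_row.
Qed.

(** * The strict inequality at an eigenvalue *)

Lemma norm_sqr_parallelogram {C : numClosedFieldType} (u v : C) :
  `|u| = 1 -> `|v| = 1 -> `|u - v| ^+ 2 = 4%:R - `|u + v| ^+ 2.
Proof.
move=> u1 v1; have uu : u * u^* = 1 by rewrite -normCK u1 expr1n.
have vv : v * v^* = 1 by rewrite -normCK v1 expr1n.
rewrite !normCK rmorphB rmorphD /=.
have -> : (u - v) * (u^* - v^* ) =
  (u * u^* + v * v^* ) * 2%:R - (u + v) * (u^* + v^* ) by ring.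
by rewrite uu vv; congr (_ - _); ring.
Qed.

(** On the unit circle the squared lengths of sum and difference add up to 4, so a shorter
    difference means a longer sum. *)
Lemma norm_sub_lt {C : numClosedFieldType} (u v w z : C) :
  `|u| = 1 -> `|v| = 1 -> `|w| = 1 -> `|z| = 1 ->
  (`|u - v| < `|w - z|) = (`|w + z| < `|u + v|).
Proof.
move=> u1 v1 w1 z1.
rewrite -(@ltr_pXn2r _ 2) ?nnegrE // -[RHS](@ltr_pXn2r _ 2) ?nnegrE //.
by rewrite !norm_sqr_parallelogram // ltrD2l ltrN2.
Qed.

(** With [p] the squared norm of [x] and [q] the form of [J] at [x], evaluating [x W J W x^*] in two
    ways gives [(l ^+ 2 + a b) q = (a + b) l p]. Then [|q| < p] yields [|a + b| < |l ^+ 2 + a b|],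
    which [norm_sub_lt] converts to differences. *)
Lemma unitary_eigenvalue_bound {C : numClosedFieldType} {n : nat} (a b l : C)
    (J W : 'M[C]_n) (x : 'rV[C]_n) :
  `|a| = 1 -> `|b| = 1 -> `|l| = 1 -> l ^+ 2 != a ^+ 2 -> l ^+ 2 != b ^+ 2 ->
  is_symmetry J -> W \is unitarymx ->
  W *m J *m W = (a + b) *: W - (a * b) *: J ->
  x != 0 -> x *m W = l *: x ->
  `|l ^+ 2 - a * b| < `|a - b|.
Proof.
move=> a1 b1 l1 la lb /is_symmetryP[hJ JJ] uW WJW x0 xW.
have l0 : l != 0 by rewrite -normr_gt0 l1.
(* Because [W] is unitary, the adjoint of a left eigenvector is a right eigenvector for the same
   eigenvalue. *)
have Wx : W *m x ^t* = l *: x ^t*.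
  have : x *m W ^t* = l^-1 *: x.
    apply: (scalerI l0); rewrite scalerA mulfV // scale1r scalemxAl -xW.
    by rewrite mulmxtVK.
  move=> /(congr1 (fun M : 'rV__ => M ^t*)); rewrite trCmx_mul trmxCK => ->.
  rewrite linearZ /= map_mxZ /=; congr (_ *: _).
  by rewrite fmorphV invC_norm norm_conjC l1 expr1n invr1 mul1r conjCK.
set p := (x *m x ^t*) 0 0; set q := (x *m J *m x ^t*) 0 0.
have p0 : 0 < p by apply: dotmx_gt0.
have Eq : (l ^+ 2 + a * b) * q = (a + b) * l * p.
  have : x *m W *m J *m W *m x ^t* = x *m (W *m J *m W) *m x ^t*.
    by rewrite !mulmxA.
  rewrite WJW xW -mulmxA Wx mulmxBr mulmxBl -!scalemxAr -!scalemxAl xW.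
  move=> /(congr1 (fun M => fun_of_matrix M 0 0)); rewrite -!scalemxAl.
  rewrite /p /q; move: (x *m J *m _) (x *m x ^t*) => Q P; rewrite !mxE => e.
  by rewrite mulrDl expr2 -mulrA e mulrA subrK.
have [pq qp] := andP (sym_form_le J x hJ JJ : - p <= q <= p).
have qR : q \is Num.real by rewrite (ler_real qp) gtr0_real.
(* If [q = e p] for a sign [e], squaring [Eq] gives [(l ^+ 2 - a ^+ 2) (l ^+ 2 - b ^+ 2) = 0]. *)
have neq (e : C) : e ^+ 2 = 1 -> q != e * p.
  move=> ee; apply/eqP => qe; move: Eq; rewrite qe mulrA => /(mulIf (lt0r_neq0 p0)).
  move=> Eq; have : (l ^+ 2 - a ^+ 2) * (l ^+ 2 - b ^+ 2) = 0.
    transitivity (((l ^+ 2 + a * b) * e) ^+ 2 - ((a + b) * l) ^+ 2).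
      by rewrite exprMn ee mulr1; ring.
    by rewrite Eq subrr.
  by apply/eqP; rewrite mulf_neq0 // subr_eq0.
have ltqp : `|q| < p.
  rewrite real_ltr_norml // !lt_neqAle pq qp !andbT.
  have := neq 1 (expr1n _ _); have := neq (-1) (sqrr_sign _ 1).
  by rewrite mulN1r mul1r eq_sym => -> ->.
rewrite norm_sub_lt ?normrM ?normrX ?l1 ?a1 ?b1 ?expr1n ?mulr1 //.
have s0 : l ^+ 2 + a * b != 0.
  apply/eqP => s0; move/eqP: Eq; rewrite s0 mul0r eq_sym mulf_eq0 (gt_eqF p0) orbF.
  rewrite mulf_eq0 (negPf l0) orbF addr_eq0 => /eqP ab.
  move: s0 la; rewrite ab mulNr => /eqP; rewrite subr_eq0 => /eqP ->.
  by rewrite sqrrN -expr2 eqxx.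
rewrite -(ltr_pM2r p0) -[p in X in X < _](gtr0_norm p0) -[X in X < _]mulr1 -l1.
by rewrite -mulrA [`|p| * _]mulrC mulrA -!normrM -Eq normrM ltr_pM2l ?normr_gt0.
Qed.

(** * Necessity: the chain of eigenvalues and the dimension count *)

Lemma symmetry_unitary {C : numClosedFieldType} {d : nat} (J : 'M[C]_d) :
  is_symmetry J -> J \is unitarymx.
Proof. by move=> /is_symmetryP[hJ JJ]; apply/unitarymxP; rewrite hJ. Qed.

(** If [V = J K L], then [J V = K L], and [(K L) K (K L) = K] by cancelling squares. *)
Lemma in_Sym3_reversible {C : numClosedFieldType} {d : nat} (V : 'M[C]_d) :
  in_Sym 3 V -> exists J K : 'M[C]_d,
    [/\ is_symmetry J, K *m K = 1%:M, J *m V \is unitarymx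
      & (J *m V) *m K *m (J *m V) = K].
Proof.
move=> /in_Sym3P[J [K [L [sJ sK sL ->]]]]; exists J, K.
have [/is_symmetryP[_ JJ] /is_symmetryP[_ KK] /is_symmetryP[_ LL]] := And3 sJ sK sL.
have -> : J *m (J *m K *m L) = K *m L by rewrite !mulmxA JJ mul1mx.
split; rewrite ?mul_unitarymx ?symmetry_unitary //.
by rewrite -!mulmxA (mulmxA K K) KK mul1mx LL mulmx1.
Qed.

Lemma two_scalar_block_quadratic {R : comPzRingType} {r s : nat} (a b : R) :
  let V : 'M[R]_(r + s) := block_mx (a%:M : 'M_r) 0 0 (b%:M : 'M_s) in
  V *m V = (a + b) *: V - (a * b)%:M.
Proof.
rewrite /= mulmx_block !mulmx0 !mul0mx !addr0 !add0r -!scalar_mxM.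
rewrite scale_block_mx !scale_scalar_mx !scaler0 [(a * b)%:M]scalar_mx_block.
rewrite opp_block_mx add_block_mx !oppr0 !addr0 -!raddfB /=.
by congr (block_mx _%:M _ _ _%:M); ring.
Qed.

Lemma rank_eigenspace_block {F : fieldType} {r s : nat} (a b : F) :
  (r <= \rank (eigenspace (block_mx (a%:M : 'M_r) 0 0 (b%:M : 'M_s)) a))%N.
Proof.
rewrite /eigenspace mxrank_ker scalar_mx_block opp_block_mx add_block_mx.
rewrite !oppr0 !addr0 subrr rank_diag_block_mx mxrank0 add0n; set k := \rank _.
by have : (k <= s)%N := rank_leq_row _; lia.
Qed.

(** Squaring merges the two forbidden values 1 and -1 into one. *)
Lemma condP_sqr_neq1 {C : numClosedFieldType} (r s : nat) (a b : C) (i j : nat) :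
  condP r s a b -> (0 < i + j < r + s)%N -> (a ^+ i * b ^+ j) ^+ 2 != 1.
Proof.
move=> [_ hP] /andP[ij0 ijd]; rewrite sqrf_eq1; apply/negP => /orP ab.
have ij : ~ (i = 0%N /\ j = 0%N) by lia.
have : (r + s <= i + j)%N by apply: hP ij _; case: ab => /eqP; [right|left].
by rewrite leqNgt ijd.
Qed.

(** Inversion followed by [l -> - a b / l] multiplies an eigenvalue by [- a b]. The step from [k] to
    [k.+1] could fail only if [a ^+ k.+2 * b ^+ k] or [a ^+ k.+1 * b ^+ k.+1] were a sign; both have
    degree [2 k + 2 <= 2 d0 < r + s]. *)
Lemma sym3_rank_chain {C : numClosedFieldType} (d0 r s : nat) (a b e : C)
    (J K W : 'M[C]_(r + s)) (k : nat) :
  `|a| = 1 -> `|b| = 1 -> condP r s a b -> (r + s = 2 * d0 + 2)%N -> e ^+ 2 = 1 ->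
  J *m J = 1%:M -> K *m K = 1%:M ->
  W *m J *m W = (a + b) *: W - (a * b) *: J -> W *m K *m W = K ->
  (k <= d0)%N ->
  (\rank (eigenspace W (e * a)) <=
   \rank (eigenspace W (e * ((- (a * b)) ^+ k * a))))%N.
Proof.
move=> a1 b1 hP hd ee JJ KK WJW WKW; elim: k => [|k IHk] kd.
  by rewrite expr0 mul1r.
have a0 : a != 0 by rewrite -normr_gt0 a1.
have b0 : b != 0 by rewrite -normr_gt0 b1.
have e0 : e != 0 by rewrite -sqrf_eq0 ee oner_neq0.
apply: leq_trans (IHk (ltnW kd)) _; set l := e * _.
have l0 : l != 0 by rewrite !(mulf_neq0, expf_neq0, oppr_eq0).
have l2 : l ^+ 2 = (a ^+ k.+1 * b ^+ k) ^+ 2.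
  by rewrite /l exprMn ee mul1r exprMn exprAC sqrrN exprAC !exprMn [a ^+ k.+1]exprS; ring.
apply: leq_trans (rank_eigenspace_inv l K W KK WKW l0) _.
have -> : e * ((- (a * b)) ^+ k.+1 * a) = - (a * b) / l^-1.
  by rewrite invrK /l exprS; ring.
apply: rank_eigenspace_refl WJW _ _ _ => //; rewrite ?invr_eq0 //.
  apply: contraTneq (condP_sqr_neq1 _ _ _ _ k.+2 k hP _) => [la|]; last by lia.
  have -> : (a ^+ k.+2 * b ^+ k) ^+ 2 = a ^+ 2 * l ^+ 2 by rewrite l2 [a ^+ k.+2]exprS; ring.
  by rewrite -la exprVn mulVf ?expf_neq0 ?eqxx.
apply: contraTneq (condP_sqr_neq1 _ _ _ _ k.+1 k.+1 hP _) => [lb|]; last by lia.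
have -> : (a ^+ k.+1 * b ^+ k.+1) ^+ 2 = b ^+ 2 * l ^+ 2 by rewrite l2 [b ^+ k.+1]exprS; ring.
by rewrite -lb exprVn mulVf ?expf_neq0 ?eqxx.
Qed.

(** The [2 (d0 + 1) = r + s] numbers [l (x, k)] are distinct, with eigenspaces of dimension at least
    [N x]. Hence [N false + N true <= 2], while [rank_cap_involution] gives
    [r - s <= N false + N true]. *)
Lemma sym3_necessary {C : numClosedFieldType} (d0 r s : nat) (a b : C) :
  `|a| = 1 -> `|b| = 1 -> condP r s a b -> (r + s = 2 * d0 + 2)%N -> (s < r)%N ->
  in_Sym 3 (block_mx (a%:M : 'M_r) 0 0 (b%:M : 'M_s)) ->
  (r <= s + 2)%N /\ forall j : nat, (1 <= j <= d0)%N ->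
        `|1 - a ^+ (2 * j + 1) * b ^+ (2 * j - 1)| < `|a - b|.
Proof.
move=> a1 b1 hP hd sr; set V := block_mx _ _ _ _.
have VV : V *m V = (a + b) *: V - (a * b)%:M := two_scalar_block_quadratic a b.
have rV : (r <= \rank (eigenspace V a))%N := rank_eigenspace_block a b.
move: V VV rV => V VV rV /in_Sym3_reversible[J [K [sJ KK]]].
have [hJ JJ] := (is_symmetryP J).1 sJ.
have := mul_conj_reflection a b J V JJ VV.
have JaE (e : C) : e ^+ 2 = 1 ->
    (\rank (eigenspace V a :&: eigenspace J e) <= \rank (eigenspace (J *m V) (e * a)))%N.
  move=> ee; apply/mxrankS/eigenspaceP; set E := (_ :&: _)%MS.
  have /eigenspaceP : (E <= eigenspace J e)%MS by apply: capmxSr.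
  have /eigenspaceP : (E <= eigenspace V a)%MS by apply: capmxSl.
  by move: E => E EV EJ; rewrite mulmxA EJ -scalemxAl EV scalerA.
move: JaE; move: (J *m V) => W JaE WJW uW WKW.
have a0 : a != 0 by rewrite -normr_gt0 a1.
have b0 : b != 0 by rewrite -normr_gt0 b1.
have ab_neq (k : nat) : (0 < k <= d0)%N -> ((- (a * b)) ^+ k) ^+ 2 != 1.
  move=> kd; rewrite exprNn exprMn [((-1) ^+ k) ^+ 2]sqrr_sign mul1r exprMn.
  by apply: (condP_sqr_neq1 r s) => //; lia.
pose N (x : bool) := \rank (eigenspace V a :&: eigenspace J ((-1) ^+ x)).
have hN : (2 * r <= N false + N true + (r + s))%N.
  rewrite /N expr0 expr1; apply: leq_trans (rank_cap_involution _ J JJ).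
  by rewrite leq_mul2l.
have chain (x : bool) (k : nat) : (k <= d0)%N ->
    (N x <= \rank (eigenspace W ((-1) ^+ x * ((- (a * b)) ^+ k * a))))%N.
  move=> kd; apply: leq_trans (JaE _ (sqrr_sign _ _)) _.
  by apply: (sym3_rank_chain d0 r s a b _ J K) => //; apply: sqrr_sign.
split.
  pose l (p : bool * 'I_d0.+1) := (-1) ^+ p.1 * ((- (a * b)) ^+ p.2 * a) : C.
  (* Squares of the values forget the sign, and [condP] then separates the exponents [k]; the sign
     is recovered last. *)
  have inj_l : injective l.
    have c0 : - (a * b) != 0 by rewrite oppr_eq0 mulf_neq0.
    have le_l (x y : bool) (k m : 'I_d0.+1) : l (x, k) = l (y, m) -> (m <= k)%N.
      move=> /(congr1 (fun z => z ^+ 2)); rewrite /l /= !exprMn !sqrr_sign !mul1r.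
      move=> /(mulIf (expf_neq0 2 a0)) e; rewrite leqNgt; apply/negP => km.
      have : (0 < m - k <= d0)%N by have := ltn_ord m; lia.
      move=> /ab_neq; rewrite -(inj_eq (mulfI (expf_neq0 2 (expf_neq0 k c0)))).
      by rewrite -exprMn -exprD subnKC 1?ltnW // mulr1 e eqxx.
    move=> [x k] [y m] e; have ekm : k = m.
      by apply/val_inj/anti_leq; rewrite (le_l _ _ _ _ e) (le_l _ _ _ _ (esym e)).
    move: e; rewrite ekm /l /= => /mulIf e; congr (_, _); apply: signr_inj.
    by apply: e; rewrite mulf_neq0 ?expf_neq0.
  have := sum_rank_eigenspace_le W l inj_l.
  rewrite -(pair_bigA _ (fun x k => \rank (eigenspace W (l (x, k))))) big_bool /=.
  have sumN x : (d0.+1 * N x <= \sum_(k < d0.+1) \rank (eigenspace W (l (x, k))))%N.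
    rewrite -[d0.+1 in leqLHS]card_ord -sum_nat_const leq_sum // => k _.
    by rewrite chain // -ltnS.
  move=> /(leq_trans (leq_add (sumN true) (sumN false))).
  have -> : (r + s = d0.+1 * 2)%N by lia.
  by rewrite -mulnDr leq_pmul2l //; lia.
move=> j /andP[j1 jd].
(* Since [s < r], [hN] prevents both numbers [N x] from vanishing. *)
have [x Nx] : exists x, (0 < N x)%N.
  by have [|] := posnP (N true); [exists false; lia|exists true].
pose l := (-1) ^+ x * ((- (a * b)) ^+ j * a).
have : eigenspace W l != 0.
  by rewrite -mxrank_eq0 -lt0n (leq_trans Nx) ?chain.
move=> /rowV0Pn[v /eigenspaceP vW v0].
have l2 : l ^+ 2 = (a ^+ j.+1 * b ^+ j) ^+ 2.
  by rewrite /l exprMn sqrr_sign mul1r exprMn exprAC sqrrN exprAC !exprMn [a ^+ j.+1]exprS; ring.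
have l1 : `|l| = 1.
  by rewrite /l normrM normr_sign mul1r normrM normrX normrN normrM a1 b1 !mulr1 expr1n.
have la : l ^+ 2 != a ^+ 2.
  have -> : l ^+ 2 = a ^+ 2 * (a ^+ j * b ^+ j) ^+ 2 by rewrite l2 [a ^+ j.+1]exprS; ring.
  rewrite -subr_eq0 -{2}[a ^+ 2]mulr1 -mulrBr mulf_neq0 ?expf_neq0 //.
  by rewrite subr_eq0; apply: (condP_sqr_neq1 r s) => //; lia.
(* Writing [j = i.+1] removes the truncated subtraction in [2 * j - 1]. *)
have [i ji] : exists i, j = i.+1 by exists j.-1; rewrite prednK.
have lb : l ^+ 2 != b ^+ 2.
  have -> : l ^+ 2 = b ^+ 2 * (a ^+ i.+2 * b ^+ i) ^+ 2.
    by rewrite l2 ji [b ^+ i.+1]exprS [a ^+ i.+2]exprS; ring.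
  rewrite -subr_eq0 -{2}[b ^+ 2]mulr1 -mulrBr mulf_neq0 ?expf_neq0 //.
  by rewrite subr_eq0; apply: (condP_sqr_neq1 r s) => //; lia.
have := unitary_eigenvalue_bound a b l J W v a1 b1 l1 la lb sJ uW WJW v0 vW.
suff -> : l ^+ 2 - a * b = - (a * b) * (1 - a ^+ (2 * j + 1) * b ^+ (2 * j - 1)).
  by rewrite normrM normrN normrM a1 b1 !mul1r.
rewrite l2 ji.
have -> : (2 * i.+1 - 1 = (2 * i).+1)%N by lia.
have -> : (2 * i.+1 + 1 = (2 * i).+3)%N by lia.
rewrite ![(2 * i)%N]mulnC -[(i * 2).+3]addn3 -[(i * 2).+1]addn1 !exprD !exprM.
by rewrite [a ^+ i.+2]exprSr [a ^+ i.+1]exprSr [b ^+ i.+1]exprSr; ring.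
Qed.

Lemma sign_of_gap {C : numClosedFieldType} (d0 : nat) (a b : C) :
  `|a| = 1 -> `|b| = 1 -> condP (d0 + 2) d0 a b -> (0 < d0)%N ->
  (forall j : nat, (1 <= j <= d0)%N ->
        `|1 - a ^+ (2 * j + 1) * b ^+ (2 * j - 1)| < `|a - b|) ->
  a ^+ (d0 + 2) * b ^+ d0 = (-1) ^+ (d0 + 1).
Proof.
move=> a1 b1 hP d0p hlt; have [ab _] := hP.
(* The wrong sign is excluded by the square root of a^r b^s if d0 is even,
   and by the middle inequality |1 - (-1)| < |a - b| if d0 is odd. *)
have [o|e] := boolP (odd d0); last first.
  rewrite -signr_odd oddD (negPf e) /= expr1.
  case: ab => // ab; exfalso.
  have := condP_sqr_neq1 _ _ _ _ (d0./2).+1 (d0./2) hP.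
  have ed : d0 = (d0./2 * 2)%N by rewrite muln2 -[LHS]odd_double_half (negPf e).
  rewrite exprMn -!exprM mulSn -ed [(2 + _)%N]addnC ab eqxx => h.
  by have := h ltac:(lia).
rewrite -signr_odd oddD o /= expr0.
case: ab => // ab; exfalso.
have /hlt : (1 <= (d0./2).+1 <= d0)%N by have := odd_double_half d0; rewrite o; lia.
have -> : (2 * (d0./2).+1 + 1 = d0 + 2)%N by have := odd_double_half d0; rewrite o; lia.
have -> : (2 * (d0./2).+1 - 1 = d0)%N by have := odd_double_half d0; rewrite o; lia.
rewrite ab opprK => h; have := lt_le_trans h (ler_normB a b).
by rewrite a1 b1 ger0_norm ?ltxx // addr_ge0.
Qed.

(** * Matrices supported on the orbits of an involution *)

(* The element f + g p of the crossed product of the functions on 'I_n by p.  At a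
   fixed point of p both f and g contribute to the diagonal entry. *)
Definition crossed_mx {R : nmodType} {n : nat} (p : 'I_n -> 'I_n)
    (f g : 'I_n -> R) : 'M[R]_n :=
  \matrix_(i, j) (f i *+ (j == i) + g i *+ (j == p i)).

Lemma eq_crossed_mx {R : nmodType} {n : nat} (p : 'I_n -> 'I_n)
    (f f' g g' : 'I_n -> R) :
  f =1 f' -> g =1 g' -> crossed_mx p f g = crossed_mx p f' g'.
Proof. by move=> ef eg; apply/matrixP => i j; rewrite !mxE ef eg. Qed.

(** Used to pass from one involution to another: a diagonal product formed over [t] can be
    multiplied by a matrix over [p]. *)
Lemma crossed_mx_diag {R : nmodType} {n : nat} (p q : 'I_n -> 'I_n) (f : 'I_n -> R) :
  crossed_mx p f (fun=> 0) = crossed_mx q f (fun=> 0).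
Proof. by apply/matrixP => i j; rewrite !mxE !mul0rn. Qed.

Lemma crossed_mxM {R : pzSemiRingType} {n : nat} (p : 'I_n -> 'I_n)
    (f g f' g' : 'I_n -> R) :
  involutive p ->
  crossed_mx p f g *m crossed_mx p f' g' =
  crossed_mx p (fun i => f i * f' i + g i * g' (p i))
               (fun i => f i * g' i + g i * f' (p i)).
Proof.
move=> pK; apply/matrixP => i k; rewrite !mxE.
have delta (c : R) (q : 'I_n) (h : 'I_n -> R) : \sum_j c *+ (j == q) * h j = c * h q.
  rewrite (bigD1 q) //= eqxx big1 ?addr0 // => j /negPf ->.
  by rewrite mulr0n mul0r.
under eq_bigr => j _ do rewrite !mxE mulrDl.
rewrite big_split /= !delta pK !mulrDr !mulrnAr !mulrnDl.
by rewrite [X in _ + X = _]addrC addrACA.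
Qed.

Lemma crossed_mx_trC {C : numClosedFieldType} {n : nat} (p : 'I_n -> 'I_n)
    (f g : 'I_n -> C) :
  involutive p ->
  (crossed_mx p f g) ^t* = crossed_mx p (fun i => (f i)^* ) (fun i => (g (p i))^* ).
Proof.
move=> pK; apply/matrixP => i j; rewrite !mxE rmorphD !rmorphMn /=.
congr (_ + _); first by rewrite eq_sym; have [->|] := eqVneq j i.
by rewrite eq_sym (can2_eq pK pK); have [->|] := eqVneq j (p i).
Qed.

Lemma crossed_mx1 {R : pzSemiRingType} {n : nat} (p : 'I_n -> 'I_n) :
  crossed_mx p (fun=> 1) (fun=> 0) = 1%:M :> 'M[R]_n.
Proof. by apply/matrixP => i j; rewrite !mxE mul0rn addr0 eq_sym. Qed.

Lemma crossed_mx_affine {R : pzRingType} {n : nat} (p : 'I_n -> 'I_n)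
    (f g : 'I_n -> R) (c k : R) :
  c *: crossed_mx p f g - k%:M =
  crossed_mx p (fun i => c * f i - k) (fun i => c * g i).
Proof.
apply/matrixP => i j; rewrite !mxE mulrDr !mulrnAr mulrnBl addrAC.
by rewrite [i == j]eq_sym.
Qed.

Lemma crossed_symmetry {C : numClosedFieldType} {n : nat} (p : 'I_n -> 'I_n)
    (f g : 'I_n -> C) :
  involutive p -> (forall i, (f i)^* = f i) -> (forall i, (g (p i))^* = g i) ->
  (forall i, f i * f i + g i * g (p i) = 1) ->
  (forall i, f i * g i + g i * f (p i) = 0) ->
  is_symmetry (crossed_mx p f g).
Proof.
move=> pK fR gR fg1 fg0; apply/is_symmetryP; split.
  by rewrite crossed_mx_trC //; apply: eq_crossed_mx.
by rewrite crossed_mxM // -(crossed_mx1 p); apply: eq_crossed_mx.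
Qed.

(** * Unitary matrices with two eigenvalues *)

Lemma count_two_valued {T : eqType} (a b : T) (s : seq T) (P : pred T) :
  a != b -> all [pred x | (x == a) || (x == b)] s ->
  count P s = (P a * count_mem a s + P b * (size s - count_mem a s))%N.
Proof.
move=> ab; elim: s => [|x s IH] /=; first by rewrite !muln0.
move=> /andP[/orP[] /eqP -> /IH ->].
  by rewrite eqxx; case: (P a); case: (P b); have := count_size (pred1 a) s; lia.
rewrite eq_sym (negPf ab); have := count_size (pred1 a) s.
by case: (P a); case: (P b); lia.
Qed.

Lemma sum_two_valued {V : nmodType} (a b : V) (s : seq V) :
  a != b -> all [pred x | (x == a) || (x == b)] s ->
  \sum_(x <- s) x = a *+ count_mem a s + b *+ (size s - count_mem a s).
Proof.
move=> ab; elim: s => [|x s IH] /=; first by rewrite big_nil !mulr0n addr0.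
move=> /andP[/orP[] /eqP -> /IH]; rewrite big_cons => ->.
  by rewrite eqxx /= add1n subSS mulrS addrA.
rewrite eq_sym (negPf ab) add0n subSn ?count_size // mulrS.
by rewrite addrCA.
Qed.

(** With [k] and [m] occurrences of [a], equal sums give [(a - b) (k - m) = 0], so [k = m] in
    characteristic 0. *)
Lemma perm_two_valued {F : numFieldType} (a b : F) (s t : seq F) :
  a != b -> all [pred x | (x == a) || (x == b)] s ->
  all [pred x | (x == a) || (x == b)] t -> size s = size t ->
  \sum_(x <- s) x = \sum_(x <- t) x -> perm_eq s t.
Proof.
move=> ab sab tab st; rewrite !(sum_two_valued a b) // st => e.
suff ek : count_mem a s = count_mem a t.
  by apply/seq.permP => P; rewrite (count_two_valued a b s) // (count_two_valued a b t) // st ek.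
have := count_size (pred1 a) s; have := count_size (pred1 a) t; rewrite st.
move: (count_mem a s) (count_mem a t) e => k m e mt ks.
have : (a - b) * (k%:R - m%:R) = 0.
  move/eqP: e; rewrite -!(mulr_natr a) -!(mulr_natr b) !natrB // -subr_eq0 => /eqP e.
  by rewrite -[RHS]e; ring.
by move/eqP; rewrite mulf_eq0 !subr_eq0 (negPf ab) /= eqr_nat => /eqP.
Qed.

Lemma perm_mx_unitary {C : numClosedFieldType} {n : nat} (p : 'S_n) :
  (perm_mx p : 'M[C]_n) \is unitarymx.
Proof.
by apply/unitarymxP; rewrite tr_perm_mx map_perm_mx -perm_mxM mulgV perm_mx1.
Qed.

(** The spectral theorem diagonalizes [A] by a unitary matrix. The quadratic relation puts the
    eigenvalues in [{a, b}], the trace fixes their multiplicities, and a permutation matrix puts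
    them in order. *)
Lemma unitary_similar_two_valued {C : numClosedFieldType} {r s : nat} (a b : C)
    (A : 'M[C]_(r + s)) :
  a != b -> A \is unitarymx -> A *m A = (a + b) *: A - (a * b)%:M ->
  \tr A = a *+ r + b *+ s ->
  exists2 U : 'M[C]_(r + s), U \is unitarymx &
    block_mx (a%:M : 'M_r) 0 0 (b%:M : 'M_s) = U *m A *m U ^t*.
Proof.
move=> ab uA AA trA.
have nA : A \is normalmx.
  apply/normalmxP; rewrite (unitarymxP uA) -(invmx_unitary uA) mulVmx //.
  exact: unitarymx_unit.
have := orthomx_spectralP nA; set P := spectralmx A; set v := spectral_diag A => eA.
have uP : P \is unitarymx := spectral_unitarymx A.
have Pu := unitarymx_unit uP.
have eD : diag_mx v = P *m A *m invmx P.
  by rewrite eA !mulmxA mulmxV // mul1mx mulmxK.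
have DD : diag_mx v *m diag_mx v = (a + b) *: diag_mx v - (a * b)%:M.
  rewrite eD !mulmxA mulmxKV // -(mulmxA P A A) AA mulmxBr mulmxBl -scalemxAr -scalemxAl.
  by rewrite mul_mx_scalar -scalemxAl mulmxV // scalemx1.
have trD : \tr (diag_mx v) = a *+ r + b *+ s.
  by rewrite eD mxtrace_mulC mulmxA mulVmx // mul1mx.
pose w : 'rV[C]_(r + s) := row_mx (const_mx a) (const_mx b).
have eV : block_mx (a%:M : 'M_r) 0 0 (b%:M : 'M_s) = diag_mx w.
  by rewrite /w diag_mx_row !diag_const_mx.
have sum_tuple (u : 'rV[C]_(r + s)) :
    \sum_(x <- [tuple u 0 i | i < r + s]) x = \tr (diag_mx u).
  rewrite big_map val_ord_tuple big_enum; apply: eq_bigr => i _.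
  by rewrite mxE eqxx mulr1n.
have eV_tr : \tr (diag_mx w) = a *+ r + b *+ s.
  by rewrite -eV mxtrace_block !mxtrace_scalar.
have : perm_eq [tuple w 0 i | i < r + s] [tuple v 0 i | i < r + s].
  apply: (perm_two_valued a b) => //.
  - apply/allP => x /mapP[i _ ->]; rewrite /w /= !mxE.
    by case: split => j; rewrite mxE eqxx ?orbT.
  - apply/allP => x /mapP[i _ ->]; move/matrixP/(_ i i): DD.
    rewrite mulmx_diag !mxE eqxx !mulr1n => /eqP e /=.
    have : (v 0 i - a) * (v 0 i - b) = 0.
      by move: e; rewrite -subr_eq0 => /eqP <-; ring.
    by move/eqP; rewrite mulf_eq0 !subr_eq0.
  - by rewrite !size_tuple.
  - by rewrite !sum_tuple trD eV_tr.
move=> /tuple_permP[p ep].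
have wv i : w 0 i = v 0 (p i).
  by have := congr1 (fun t => nth 0 t i) ep; rewrite -!tnth_nth !tnth_mktuple.
exists (perm_mx p *m P); first by rewrite mul_unitarymx ?perm_mx_unitary.
rewrite trCmx_mul tr_perm_mx map_perm_mx eV !mulmxA -(mulmxA _ P) -(mulmxA _ _ (P ^t*)).
rewrite -(invmx_unitary uP) -eD -row_permE -col_permE.
apply/matrixP => i j; rewrite [LHS]mxE wv !mxE; congr (_ *+ _).
by rewrite (inj_eq perm_inj).
Qed.

Lemma in_Sym3_unitary_conj {C : numClosedFieldType} {n : nat} (A U : 'M[C]_n) :
  U \is unitarymx -> in_Sym 3 A -> in_Sym 3 (U *m A *m U ^t*).
Proof.
move=> uU /in_Sym3P[J [K [L [sJ sK sL ->]]]].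
have UU : U ^t* *m U = 1%:M.
  by rewrite -(invmx_unitary uU) mulVmx // unitarymx_unit.
have sU (M : 'M[C]_n) : is_symmetry M -> is_symmetry (U *m M *m U ^t*).
  move=> /is_symmetryP[hM MM]; apply/is_symmetryP; split.
    by rewrite !trCmx_mul hM trmxCK mulmxA.
  rewrite -!mulmxA (mulmxA (U ^t*) U) UU mul1mx (mulmxA M M) MM mul1mx.
  exact/unitarymxP.
apply/in_Sym3P; exists (U *m J *m U ^t*), (U *m K *m U ^t*), (U *m L *m U ^t*).
split; try exact: sU.
by rewrite -!mulmxA (mulmxA (U ^t*) U) UU mul1mx (mulmxA (U ^t*) U) UU mul1mx.
Qed.

(** * Sufficiency: the explicit construction *)

Lemma conj_unit {C : numClosedFieldType} (z : C) : `|z| = 1 -> z^* = z^-1.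
Proof. by move=> z1; rewrite invC_norm z1 expr1n invr1 mul1r. Qed.

(* The third symmetry is block diagonal along the orbits of p, with real entries
   f and g chosen so that each block of diag(mu) times it has spectrum {a, b}, or
   {a} on a fixed point; diag(mu) is the product of two symmetries by way of t. *)
Lemma matching_sym3 {C : numClosedFieldType} {r s : nat} (a b : C)
    (p t : 'I_(r + s) -> 'I_(r + s)) (mu : 'I_(r + s) -> C) :
  `|a| = 1 -> `|b| = 1 -> a != b -> involutive p -> involutive t ->
  (forall i, `|mu i| = 1) -> (forall i, mu (t i) = (mu i)^-1) ->
  (forall i, p i = i -> mu i ^+ 2 = a ^+ 2) ->
  (forall i, p i != i -> mu i * mu (p i) = - (a * b)) ->
  (forall i, p i != i -> `|mu i + mu (p i)| < `|a - b|) ->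
  (#|[pred i | p i == i]| + s)%N = r ->
  in_Sym 3 (block_mx (a%:M : 'M_r) 0 0 (b%:M : 'M_s)).
Proof.
move=> a1 b1 ab pK tK mu1 mut mufix mup mulp card_fix.
have mu0 i : mu i != 0 by rewrite -normr_gt0 mu1.
have a0 : a != 0 by rewrite -normr_gt0 a1.
have b0 : b != 0 by rewrite -normr_gt0 b1.
have pfix i : (p (p i) == p i) = (p i == i) by rewrite pK eq_sym.
have gap i : p i != i -> `|a + b| < `|mu i - mu (p i)|.
  by move=> pi; rewrite -norm_sub_lt ?normrN ?mu1 // opprK mulp.
(* On a two-point orbit [f] changes sign, so trace [a + b] forces this value; the determinant is
   then [- mu i * mu (p i) * (f i ^+ 2 + g i ^+ 2) = a b]. By [gap], [|f i| < 1], so [g i] is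
   real. *)
pose f i := if p i == i then a / mu i else (a + b) / (mu i - mu (p i)).
pose g i := if p i == i then 0 else sqrtC (1 - f i ^+ 2).
have dmu i : p i != i -> mu i - mu (p i) != 0.
  by move=> /gap lt; rewrite -normr_gt0 (le_lt_trans _ lt).
have fp i : p i != i -> f (p i) = - f i.
  move=> pi; rewrite /f pfix (negPf pi) pK -[mu (p i) - _]opprB.
  by rewrite invrN mulrN.
have fR i : (f i)^* = f i.
  rewrite /f; case: eqP => [/mufix e|/eqP pi].
    rewrite rmorphM /= fmorphV /= !conj_unit // invrK.
    have -> : a^-1 * mu i = mu i ^+ 2 / (a * mu i) by field; rewrite a0 mu0.
    by rewrite e; field; rewrite a0 mu0.
  rewrite rmorphM /= fmorphV rmorphB rmorphD /= !conj_unit //.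
  have e := mup i pi; have d := dmu i pi; have m1 := mu0 i; have m2 := mu0 (p i).
  have -> : a^-1 + b^-1 = (a + b) / (a * b) by field; rewrite a0 b0.
  have -> : (mu i)^-1 - (mu (p i))^-1 = (mu i - mu (p i)) / (a * b).
    by rewrite -[a * b]opprK -e; field; rewrite m1 m2.
  by field; rewrite d a0 b0.
have fix1 i : p i == i -> f i ^+ 2 = 1.
  move=> /[dup] pi /eqP/mufix e; rewrite /f pi expr_div_n e divff //.
  by rewrite expf_neq0.
have f2 i : 0 <= 1 - f i ^+ 2.
  have [/fix1 ->|pi] := boolP (p i == i); first by rewrite subrr.
  have fr : f i \is Num.real by apply/CrealP.
  rewrite subr_ge0 -real_normK // expr_le1 // /f (negPf pi) normrM normfV.
  by rewrite ler_pdivrMr ?mul1r ?ltW ?gap // normr_gt0 dmu.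
have gp i : g (p i) = g i.
  rewrite /g pfix; case: (boolP (p i == i)) => // pi.
  by rewrite fp // sqrrN.
have gR i : (g i)^* = g i.
  apply/CrealP; rewrite /g; case: ifP => // _.
  by rewrite ger0_real // sqrtC_ge0.
have fg1 i : f i * f i + g i * g i = 1.
  rewrite -!expr2 /g; case: (boolP (p i == i)) => [/fix1 ->|_].
    by rewrite expr0n addr0.
  by rewrite sqrtCK addrC subrK.
have fg0 i : g i * (f i + f (p i)) = 0.
  have [pi|pi] := boolP (p i == i); first by rewrite /g pi mul0r.
  by rewrite fp // subrr mulr0.
have sJ : is_symmetry (crossed_mx p f g).
  apply: crossed_symmetry => // i; rewrite ?gp //.
  by rewrite -[RHS](fg0 i); ring.
have s1 : is_symmetry (crossed_mx t (fun=> 0) mu).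
  apply: crossed_symmetry => // i; rewrite ?rmorph0 ?mulr0 ?mul0r ?add0r //.
    by rewrite conj_unit // mut invrK.
  by rewrite mut mulfV.
have s2 : is_symmetry (crossed_mx t (fun=> 0) (fun=> 1 : C)).
  by apply: crossed_symmetry => // i; rewrite ?rmorph0 ?rmorph1 ?mulr0 ?mul0r ?add0r ?mulr1.
pose A := crossed_mx t (fun=> 0) mu *m crossed_mx t (fun=> 0) (fun=> 1) *m crossed_mx p f g.
have sA : in_Sym 3 A by apply/in_Sym3P; do 3!eexists; split; last reflexivity.
have uA : A \is unitarymx by rewrite !mul_unitarymx ?symmetry_unitary.
have eA : A = crossed_mx p (fun i => mu i * f i) (fun i => mu i * g i).
  rewrite /A crossed_mxM //.
  have -> : crossed_mx t (fun i => 0 * 0 + mu i * 1) (fun i => 0 * 1 + mu i * 0) =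
            crossed_mx p mu (fun=> 0).
    rewrite -(crossed_mx_diag t p); apply: eq_crossed_mx => i.
      by rewrite mul0r add0r mulr1.
    by rewrite mul0r add0r mulr0.
  rewrite crossed_mxM //.
  by apply: eq_crossed_mx => i; rewrite !mul0r addr0.
have muf i : p i != i -> mu i * f i + mu (p i) * f (p i) = a + b.
  move=> pi; rewrite fp // mulrN -mulrBl /f (negPf pi).
  by rewrite mulrC divfK // dmu.
have muf_fix i : p i == i -> mu i * f i = a.
  by move=> pi; rewrite /f pi mulrC divfK.
have AA : A *m A = (a + b) *: A - (a * b)%:M.
  rewrite eA crossed_mxM // crossed_mx_affine; apply: eq_crossed_mx => i.
    have [pi|pi] := boolP (p i == i).
      by rewrite muf_fix // /g pi mulr0 mul0r; ring.
    have e := muf i pi; have e' := mup i pi; have e'' := fg1 i.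
    rewrite gp -e fp //.
    have -> : a * b = - (mu i * mu (p i)) by rewrite e' opprK.
    transitivity (mu i ^+ 2 * f i ^+ 2 + mu i * mu (p i) * (g i * g i)); first by ring.
    have -> : g i * g i = 1 - f i * f i by rewrite -e''; ring.
    by ring.
  have [pi|pi] := boolP (p i == i); first by rewrite /g pi !mulr0 mul0r addr0.
  by rewrite -(muf i pi); ring.
have trA : \tr A = a *+ r + b *+ s.
  have -> : \tr A = \sum_i mu i * f i.
    rewrite eA; apply: eq_bigr => i _; rewrite mxE eqxx mulr1n /g.
    by rewrite [i == p i]eq_sym; case: (p i == i); rewrite ?mulr0 ?mul0rn addr0.
  apply: (mulfI (_ : 2%:R != 0)); first by rewrite pnatr_eq0.
  (* Doubling the trace and reindexing one copy by [p] pairs [i] with [p i] without choosing orbit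
     representatives. *)
  rewrite mulr_natl mulr2n {2}(reindex_inj (inv_inj pK)) /= -big_split /=.
  rewrite (bigID [pred i | p i == i]) /=.
  rewrite (eq_bigr (fun=> 2%:R * a)); last first.
    by move=> i pi; rewrite (eqP pi) muf_fix //; ring.
  rewrite [X in _ + X](eq_bigr (fun=> a + b)); last by move=> i; apply: muf.
  rewrite !sumr_const.
  have -> : #|[pred i | p i != i]| = (2 * s)%N.
    apply: (@addnI #|[pred i | p i == i]|); transitivity #|'I_(r + s)|.
      by rewrite -(cardC [pred i | p i == i]); congr addn; apply: eq_card.
    by rewrite card_ord -[in LHS]card_fix -addnA addnn -mul2n.
  have -> : a *+ r = a *+ #|[pred i | p i == i]| + a *+ s by rewrite -mulrnDr card_fix.
  move: #|_| => k.
  by ring.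
have [U uU ->] := unitary_similar_two_valued a b A ab uA AA trA.
exact: in_Sym3_unitary_conj.
Qed.

(* [swap_nat] pairs 2k with 2k+1; [shifted_swap_nat m], for m odd, pairs 2k+1 with
   2k+2 and fixes both ends 0 and m. *)
Definition swap_nat (n : nat) : nat := if odd n then n.-1 else n.+1.

Definition shifted_swap_nat (m n : nat) : nat :=
  if (n == 0%N) || (n == m) then n else if odd n then n.+1 else n.-1.

(** The sequence [mu] is [lam 0], [1 / lam 0], ..., [lam d0], [1 / lam d0]. [swap_nat] pairs
    inverses; [shifted_swap_nat] pairs [1 / lam k] with [lam k.+1], of product [- a b]. Its two
    fixed points account for [r - s = 2]. *)
Lemma sym3_sufficient {C : numClosedFieldType} (d0 : nat) (a b : C) :
  `|a| = 1 -> `|b| = 1 -> a != b ->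
  a ^+ (d0 + 2) * b ^+ d0 = (-1) ^+ (d0 + 1) ->
  (forall j : nat, (1 <= j <= d0)%N ->
        `|1 - a ^+ (2 * j + 1) * b ^+ (2 * j - 1)| < `|a - b|) ->
  in_Sym 3 (block_mx (a%:M : 'M_(d0 + 2)) 0 0 (b%:M : 'M_d0)).
Proof.
move=> a1 b1 ab abd hlt.
have a0 : a != 0 by rewrite -normr_gt0 a1.
have b0 : b != 0 by rewrite -normr_gt0 b1.
pose lam (k : nat) := (- (a * b)) ^+ k * a.
have lam1 k : `|lam k| = 1 by rewrite normrM normrX normrN normrM a1 b1 !mulr1 expr1n.
have lam0 k : lam k != 0 by rewrite -normr_gt0 lam1.
pose mu (n : nat) := if odd n then (lam n./2)^-1 else lam n./2.
pose m := (2 * d0).+1.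
have mu_odd k : mu (2 * k).+1 = (lam k)^-1.
  by rewrite /mu /= mul2n odd_double /= uphalf_double.
have mu_even k : mu (2 * k)%N = lam k.
  by rewrite /mu mul2n odd_double doubleK.
have inner k : (k < d0)%N ->
    mu (2 * k).+1 * mu (2 * k.+1)%N = - (a * b) /\
    `|mu (2 * k).+1 + mu (2 * k.+1)%N| < `|a - b|.
  move=> kd; rewrite mu_odd mu_even.
  have -> : lam k.+1 = - (a * b) * lam k by rewrite /lam exprS mulrA.
  split; first by rewrite mulrCA mulVf ?mulr1.
  have /hlt : (1 <= k.+1 <= d0)%N by [].
  suff -> : 1 - a ^+ (2 * k.+1 + 1) * b ^+ (2 * k.+1 - 1) =
         lam k * ((lam k)^-1 + - (a * b) * lam k) by rewrite normrM lam1 mul1r.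
  rewrite mulrDr mulfV //; congr (_ + _); rewrite mulrCA mulNr -expr2; congr (- _).
  rewrite /lam exprMn exprAC sqrrN exprAC !exprMn.
  have -> : (2 * k.+1 - 1 = k * 2 + 1)%N by lia.
  have -> : (2 * k.+1 + 1 = k * 2 + 3)%N by lia.
  by rewrite !exprD !exprM; ring.
have split_nat n : (n < m.+1)%N -> [\/ n = 0%N, n = m,
    exists2 k, (k < d0)%N & n = (2 * k).+1 | exists2 k, (k < d0)%N & n = (2 * k.+1)%N].
  move=> nm; have := odd_double_half n; case: (odd n) => /= e.
    have [h|h] := ltnP n./2 d0; first by apply: Or43; exists n./2 => //; lia.
    by apply: Or42; rewrite /m; lia.
  case: (posnP n./2) => h; first by apply: Or41; lia.
  by apply: Or44; exists n./2.-1; lia.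
have sw_odd k : swap_nat (2 * k).+1 = (2 * k)%N by rewrite /swap_nat /= mul2n odd_double.
have sw_even k : swap_nat (2 * k) = (2 * k).+1 by rewrite /swap_nat mul2n odd_double.
have sh_odd k : (k < d0)%N -> shifted_swap_nat m (2 * k).+1 = (2 * k.+1)%N.
  move=> kd; rewrite /shifted_swap_nat /m eqSS /= mul2n odd_double /=.
  by case: eqP => [|_]; lia.
have sh_even k : (k < d0)%N -> shifted_swap_nat m (2 * k.+1) = (2 * k).+1.
  move=> kd; rewrite /shifted_swap_nat mul2n odd_double /m /=.
  by case: eqP => [|_]; lia.
have sh0 : shifted_swap_nat m 0 = 0%N by [].
have shm : shifted_swap_nat m m = m by rewrite /shifted_swap_nat eqxx orbT.
have dm : (d0 + 2 + d0 = m.+1)%N by rewrite /m; lia.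
have sw_lt n : (n < m.+1)%N -> (swap_nat n < m.+1)%N /\ swap_nat (swap_nat n) = n.
  move=> nm; have := odd_double_half n; case: (odd n) => /= e.
    have -> : n = (2 * n./2).+1 by lia.
    by rewrite sw_odd sw_even; split => //; rewrite /m in nm *; lia.
  have -> : n = (2 * n./2)%N by lia.
  by rewrite sw_even sw_odd; split => //; rewrite /m in nm *; lia.
have sh_lt n : (n < m.+1)%N ->
    (shifted_swap_nat m n < m.+1)%N /\ shifted_swap_nat m (shifted_swap_nat m n) = n.
  move=> /split_nat[->|->|[k kd ->]|[k kd ->]]; rewrite ?(sh0, shm) //.
    by rewrite sh_odd // sh_even //; split => //; rewrite /m; lia.
  by rewrite sh_even // sh_odd //; split => //; rewrite /m; lia.
have ltm (i : 'I_(d0 + 2 + d0)) : (i < m.+1)%N by rewrite -dm.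
(* The default of [insubd] is never taken: [sh_lt] and [sw_lt] keep the images in range. *)
pose p (i : 'I_(d0 + 2 + d0)) := insubd i (shifted_swap_nat m i).
pose t (i : 'I_(d0 + 2 + d0)) := insubd i (swap_nat i).
have pE i : p i = shifted_swap_nat m i :> nat.
  by have := (sh_lt i (ltm i)).1; rewrite -dm => lt; rewrite val_insubd lt.
have tE i : t i = swap_nat i :> nat.
  by have := (sw_lt i (ltm i)).1; rewrite -dm => lt; rewrite val_insubd lt.
have pfix i : p i = i -> i = 0%N :> nat \/ i = m :> nat.
  move=> /(congr1 val) /=; rewrite pE.
  have [->|->|[k kd ->]|[k kd ->]] := split_nat i (ltm i); [by left|by right| |].
    by rewrite sh_odd //; lia.
  by rewrite sh_even //; lia.
have inner_p i : p i != i -> mu i * mu (p i) = - (a * b) /\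
    `|mu i + mu (p i)| < `|a - b|.
  rewrite -val_eqE /= pE.
  have [->|->|[k kd ->]|[k kd ->]] := split_nat i (ltm i).
  - by rewrite sh0.
  - by rewrite shm eqxx.
  - by rewrite sh_odd // => _; apply: inner.
  - by rewrite sh_even // => _; rewrite mulrC addrC; apply: inner.
apply: (matching_sym3 a b p t (fun i => mu i)) => //.
- by move=> i; apply: val_inj; rewrite /= !pE (sh_lt i (ltm i)).2.
- by move=> i; apply: val_inj; rewrite /= !tE (sw_lt i (ltm i)).2.
- by move=> i; rewrite /mu; case: ifP => _; rewrite ?normfV lam1 ?invr1.
- move=> i; rewrite tE; have := odd_double_half i; case: (odd i) => /= e.
    have -> : (i : nat) = (2 * i./2).+1 by lia.
    by rewrite sw_odd mu_odd mu_even invrK.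
  have -> : (i : nat) = (2 * i./2)%N by lia.
  by rewrite sw_even mu_odd mu_even.
- move=> i /pfix[->|->]; first by rewrite (mu_even 0%N) /lam expr0 mul1r.
  rewrite /m mu_odd.
  (* At the last index [mu] is [1 / lam d0], and [lam d0 * a] is up to sign
     [a ^+ (d0 + 2) * b ^+ d0], itself a sign by [abd]. *)
  suff h : (lam d0 * a) ^+ 2 = 1.
    by apply: (mulfI (expf_neq0 2 (lam0 d0))); rewrite -[RHS]exprMn h exprVn mulfV ?expf_neq0.
  have -> : lam d0 * a = (-1) ^+ d0 * (a ^+ (d0 + 2) * b ^+ d0).
    by rewrite /lam [(- (a * b)) ^+ d0]exprNn exprMn exprD; move: ((-1) ^+ d0) => e; ring.
  by rewrite abd -exprD sqrr_sign.
- by move=> i /inner_p[].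
- by move=> i /inner_p[].
have lt0 : (0 < d0 + 2 + d0)%N by lia.
have ltM : (m < d0 + 2 + d0)%N by lia.
rewrite (eq_card (B := pred2 (Ordinal lt0) (Ordinal ltM))).
  by rewrite card2 -val_eqE /= addnC.
move=> i; rewrite !inE -!val_eqE /= pE.
have [->|->|[k kd ->]|[k kd ->]] := split_nat i (ltm i).
- by rewrite sh0.
- by rewrite shm !eqxx orbT.
- by rewrite sh_odd // /m; lia.
- by rewrite sh_even // /m; lia.
Qed.

Local Open Scope complex_scope.

Theorem theorem3p13 (R : realType) (d r s d0 : nat) (alpha beta : R[i])
    (V : 'M[R[i]]_(r + s))
    (hd4 : (4 <= d)%N) (hdeven : ~~ odd d) (hd : d = (r + s)%N)
    (hs : (1 <= s)%N) (hsr : (s < r)%N)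
    (halpha : `|alpha| = 1) (hbeta : `|beta| = 1) (hab : alpha <> beta)
    (hP : condP r s alpha beta)
    (hd0 : d0 = ((d - 2) %/ 2)%N)
    (hV : V = block_mx (alpha%:M : 'M_r) 0 0 (beta%:M : 'M_s)) :
  in_Sym 3 V <->
  [/\ r = (d0 + 2)%N, s = d0,
      alpha ^+ r * beta ^+ s = (-1) ^+ (d0 + 1)
    & forall j : nat, (1 <= j <= d0)%N ->
        `|1 - alpha ^+ (2 * j + 1) * beta ^+ (2 * j - 1)| < `|alpha - beta|].
Proof.
have rs : (r + s = 2 * d0 + 2)%N by have := odd_double_half d; lia.
split=> [|[er es sgn gap]]; subst V.
  move=> /(sym3_necessary d0) [] // rs2 gap.
  (* The sum [r + s] is even and [s < r <= s + 2], so [r - s = 2]. *)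
  have er : r = (d0 + 2)%N by lia.
  have es : s = d0 by lia.
  split=> //; rewrite er es; apply: sign_of_gap => //; first by rewrite -{2}es -er.
  by lia.
rewrite {}er {}es in sgn *.
by apply: sym3_sufficient => //; apply/eqP.
Qed.
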